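(* Let $\mathbb{H}$ be a separable real Hilbert space and let $X$ be a random element of $\mathbb{H}$ that is regularly varying with some index $\alpha>0$ and limit angular measure $P_{\Theta,\infty}$ on the unit sphere of $\mathbb{H}$. Let $R=\|X\|$, $\Theta=X/\|X\|$, $C_t=\mathbb{E}[\Theta\otimes\Theta\mid R>t]$ for $t>0$, and $C_\infty=\mathbb{E}[\Theta_\infty\otimes\Theta_\infty]$ with $\Theta_\infty\sim P_{\Theta,\infty}$. Then, as $t\to\infty$, $$\|C_t-C_\infty\|_{HS(\mathbb{H})}\to0.$$
   Context: For $f,g\in\mathbb{H}$, $f\otimes g$ is the operator $h\mapsto\langle f,h\rangle g$. $HS(\mathbb{H})$ is the Hilbert space of Hilbert–Schmidt operators on $\mathbb{H}$ with norm $\|T\|_{HS(\mathbb{H})}=(\sum_i\|Te_i\|^2)^{1/2}$ for any orthonormal basis $(e_i)$; expectations of operators are Bochner integrals in $HS(\mathbb{H})$. Regular variation. Let $\mathbb{H}_0=\mathbb{H}\setminus\{0\}$. Let $\mathcal{C}_0$ be the set of bounded continuous functions $f:\mathbb{H}_0\to\mathbb{R}$ vanishing in some neighborhood of $0$, and $M_0$ the class of Borel measures on $\mathbb{H}_0$ that are finite on every Borel subset bounded away from $0$. $\mu_n\to\mu$ in $M_0$ if $\int f\,d\mu_n\to\int f\,d\mu$ for all $f\in\mathcal{C}_0$. A measurable function $b$ is regularly varying with index $\rho$ if $b(tx)/b(t)\to x^\rho$ as $t\to\infty$ for every $x>0$. $X$ is regularly varying with index $\alpha>0$ if there exist a nonzero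 $\mu\in M_0$ and a regularly varying function $b$ such that $b(n)\mathbb{P}(X\in n\,\cdot)\to\mu$ in $M_0$ as $n\to\infty$, where $\mu(tA)=t^{-\alpha}\mu(A)$ for all $t>0$ and Borel $A\subset\mathbb{H}_0$. Known equivalent characterization (polar form): $X$ is regularly varying with index $\alpha$ if and only if $\|X\|$ is regularly varying in $\mathbb{R}$ with index $\alpha$ and there is a probability measure $P_{\Theta,\infty}$ on the unit sphere such that $P_{\Theta,t}:=\mathbb{P}(\Theta\in\cdot\mid R>t)\to P_{\Theta,\infty}$ weakly as $t\to\infty$; this $P_{\Theta,\infty}$ is the limit angular measure. *)

(* Defs.v *)
From HB Require Import structures.
From mathcomp Require Import all_boot all_order all_algebra.
From mathcomp Require Import all_classical all_reals all_analysis.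
From mathcomp Require Import ring.

Set Implicit Arguments.
Unset Strict Implicit.
Unset Printing Implicit Defensive.

Import Order.TTheory GRing.Theory Num.Theory numFieldNormedType.Exports.

Local Open Scope classical_set_scope.
Local Open Scope ring_scope.

HB.mixin Record hasInner (R : realType) H & CompleteNormedModule R H := {
  inner : H -> H -> R;
  innerC : forall x y, inner x y = inner y x;
  innerDZl : forall a x y z, inner (a *: x + y) z = a * inner x z + inner y z;
  inner_sqnorm : forall x, inner x x = `|x| ^+ 2
}.

#[short(type="hilbertType")]
HB.structure Definition Hilbert (R : realType) :=
  {H of CompleteNormedModule R H & hasInner R H}.

Definition separable (T : topologicalType) : Prop :=
  exists2 D : set T, countable D & dense D.

Section inner_theory.
Context {R : realType} {H : hilbertType R}.
Implicit Types (x y z : H) (a : R).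

Lemma innerDl x y z : inner (x + y) z = inner x z + inner y z.
Proof. by have := innerDZl 1 x y z; rewrite scale1r mul1r. Qed.

Lemma inner0l z : inner 0 z = 0.
Proof.
have := innerDl 0 0 z; rewrite addr0 => /eqP.
by rewrite eq_sym -subr_eq0 addrK => /eqP.
Qed.

Lemma innerZl a x z : inner (a *: x) z = a * inner x z.
Proof. by rewrite -[a *: x]addr0 innerDZl inner0l addr0. Qed.

Lemma innerBl x y z : inner (x - y) z = inner x z - inner y z.
Proof. by rewrite innerDl -scaleN1r innerZl mulN1r. Qed.

Lemma innerDr x y z : inner z (x + y) = inner z x + inner z y.
Proof. by rewrite innerC innerDl !(innerC z). Qed.

Lemma innerZr a x z : inner z (a *: x) = a * inner z x.
Proof. by rewrite innerC innerZl (innerC z). Qed.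

Lemma innerBr x y z : inner z (x - y) = inner z x - inner z y.
Proof. by rewrite innerC innerBl !(innerC z). Qed.

Lemma sqnormB x y : `|x - y| ^+ 2 = `|x| ^+ 2 - 2 * inner x y + `|y| ^+ 2.
Proof.
rewrite -!inner_sqnorm innerBl !innerBr (innerC y x); ring.
Qed.

Lemma inner_le x y : inner x y <= `|x| * `|y|.
Proof.
have [->|x0] := eqVneq x 0; first by rewrite inner0l normr0 mul0r.
have [->|y0] := eqVneq y 0; first by rewrite innerC inner0l normr0 mulr0.
have nx : 0 < `|x| by rewrite normr_gt0.
have ny : 0 < `|y| by rewrite normr_gt0.
have := sqr_ge0 `| `|y| *: x - `|x| *: y|.
rewrite sqnormB innerZl innerZr !normrZ !normr_id.
have -> : (`|y| * `|x|) ^+ 2 - 2 * (`|y| * (`|x| * inner x y)) +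
  (`|x| * `|y|) ^+ 2 = (2 * (`|x| * `|y|)) * (`|x| * `|y| - inner x y) by ring.
by rewrite pmulr_rge0 ?subr_ge0// mulr_gt0// mulr_gt0.
Qed.

Lemma CauchySchwarz_inner x y : `|inner x y| <= `|x| * `|y|.
Proof.
rewrite ler_norml inner_le andbT lerNl -mulN1r -innerZl.
by rewrite (le_trans (inner_le _ _))// normrZ normrN1 mul1r.
Qed.

End inner_theory.

Definition linspan (R : realType) (V : lmodType R) (B : set V) : set V :=
  [set x | exists (s : seq V) (c : V -> R),
    (forall v, v \in s -> B v) /\ x = \sum_(v <- s) c v *: v].

Record onb (R : realType) (H : hilbertType R) := Onb {
  onb_set :> set H;
  onb_orthonormal : forall x y, onb_set x -> onb_set y ->
    inner x y = (x == y)%:R;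
  onb_total : dense (linspan onb_set)
}.

Section esum_seq.
Context {R : realType} {I : choiceType}.
Implicit Types (D : set I) (a : I -> R).

Lemma esum_seq_le D a M :
  (forall s, uniq s -> (forall x, x \in s -> D x) -> \sum_(x <- s) a x <= M) ->
  (\esum_(x in D) (a x)%:E <= M%:E)%E.
Proof.
move=> sM; apply: ge_ereal_sup => _ [F [finF FD] <-].
rewrite fsbig_finite//= sumEFin lee_fin; apply: sM => //.
by move=> x; rewrite in_fset_set// inE => /FD.
Qed.

Lemma seq_le_esum D a s : uniq s -> (forall x, x \in s -> D x) ->
  ((\sum_(x <- s) a x)%:E <= \esum_(x in D) (a x)%:E)%E.
Proof.
move=> us sD; apply: esum_ge; exists [set` s].
  by split=> //; exact: finite_seq.
by rewrite -fsbig_seq// sumEFin.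
Qed.

End esum_seq.

Section hilbert_schmidt.
Context {R : realType} {H : hilbertType R} (e : onb H).
Implicit Types (T : H -> H).

(* The value does not depend on the orthonormal basis e; hs e below is HS(H)
   with its norm computed in e. *)
Definition hs_sqnorm T : \bar R := (\esum_(x in e) (`|T x| ^+ 2)%:E)%E.

Definition is_hs T :=
  [/\ linear T, continuous T & (hs_sqnorm T < +oo)%E].

Definition hs_pred : {pred H -> H} := fun T => `[< is_hs T >].

Lemma hs_predP T : reflect (is_hs T) (T \in hs_pred).
Proof. exact: asboolP. Qed.

Lemma hs_sqnorm_ge0 T : (0 <= hs_sqnorm T)%E.
Proof. by apply: esum_ge0 => x _; rewrite lee_fin sqr_ge0. Qed.

Definition hs_norm T : R := Num.sqrt (fine (hs_sqnorm T)).

Lemma hs_norm_ge0 T : 0 <= hs_norm T. Proof. exact: sqrtr_ge0. Qed.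

Lemma hs_sqnormE T : (hs_sqnorm T < +oo)%E ->
  hs_sqnorm T = (hs_norm T ^+ 2)%:E.
Proof.
move=> Too; rewrite sqr_sqrtr ?fine_ge0 ?hs_sqnorm_ge0// fineK//.
by rewrite ge0_fin_numE// hs_sqnorm_ge0.
Qed.

Lemma hs_norm_ub T s : (hs_sqnorm T < +oo)%E ->
  uniq s -> (forall x, x \in s -> onb_set e x) ->
  \sum_(x <- s) `|T x| ^+ 2 <= hs_norm T ^+ 2.
Proof.
move=> Too us se; rewrite -lee_fin -hs_sqnormE//.
exact: (@seq_le_esum _ _ _ (fun x => `|T x| ^+ 2)).
Qed.

Lemma hs_norm_le T M : 0 <= M ->
  (forall s, uniq s -> (forall x, x \in s -> onb_set e x) ->
     \sum_(x <- s) `|T x| ^+ 2 <= M ^+ 2) ->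
  (hs_sqnorm T < +oo)%E /\ hs_norm T <= M.
Proof.
move=> M0 sM; have TM := esum_seq_le sM.
have Too : (hs_sqnorm T < +oo)%E by exact: le_lt_trans TM (ltry _).
split=> //; rewrite -(@ler_pXn2r _ 2)// ?nnegrE ?hs_norm_ge0//.
by rewrite -lee_fin -hs_sqnormE.
Qed.

Lemma hs_normZ_le (a : R) T : (hs_sqnorm T < +oo)%E ->
  (hs_sqnorm (a *: T)%R < +oo)%E /\ hs_norm (a *: T) <= `|a| * hs_norm T.
Proof.
move=> Too; apply: hs_norm_le => [|s us se].
  by rewrite mulr_ge0// hs_norm_ge0.
under eq_bigr do rewrite /= normrZ exprMn.
by rewrite -mulr_sumr exprMn ler_wpM2l ?sqr_ge0// hs_norm_ub.
Qed.

Lemma hs_normD_le S T : (hs_sqnorm S < +oo)%E -> (hs_sqnorm T < +oo)%E ->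
  (hs_sqnorm (S \+ T)%R < +oo)%E /\ hs_norm (S \+ T) <= hs_norm S + hs_norm T.
Proof.
move=> Soo Too; apply: hs_norm_le => [|s us se].
  by rewrite addr_ge0// hs_norm_ge0.
have Ss := hs_norm_ub Soo us se; have Ts := hs_norm_ub Too us se.
have : \sum_(x <- s) `|(S \+ T) x| ^+ 2 <=
    \sum_(x <- s) (`|S x| + `|T x|) ^+ 2.
  by apply: ler_sum => x _; rewrite ler_pXn2r ?nnegrE ?addr_ge0// ler_normD.
move/le_trans; apply.
have [a0|a0] := eqVneq (hs_norm S) 0.
  rewrite a0 add0r; apply: le_trans Ts; rewrite big_seq [leRHS]big_seq.
  apply: ler_sum => x xs; suff -> : `|S x| = 0 by rewrite add0r.
  move: Ss; rewrite a0 expr0n/= => Ss; apply/eqP.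
  rewrite -sqrf_eq0 eq_le sqr_ge0 andbT (le_trans _ Ss)//.
  by rewrite (big_rem x)//= lerDl sumr_ge0// => y _; rewrite sqr_ge0.
have [b0|b0] := eqVneq (hs_norm T) 0.
  rewrite b0 addr0; apply: le_trans Ss; rewrite big_seq [leRHS]big_seq.
  apply: ler_sum => x xs; suff -> : `|T x| = 0 by rewrite addr0.
  move: Ts; rewrite b0 expr0n/= => Ts; apply/eqP.
  rewrite -sqrf_eq0 eq_le sqr_ge0 andbT (le_trans _ Ts)//.
  by rewrite (big_rem x)//= lerDl sumr_ge0// => y _; rewrite sqr_ge0.
have {}a0 : 0 < hs_norm S by rewrite lt0r a0 hs_norm_ge0.
have {}b0 : 0 < hs_norm T by rewrite lt0r b0 hs_norm_ge0.
set a := hs_norm S in Ss a0 *; set b := hs_norm T in Ts b0 *.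
apply: (@le_trans _ _ (\sum_(x <- s) ((1 + b / a) * `|S x| ^+ 2 +
    (1 + a / b) * `|T x| ^+ 2))).
  apply: ler_sum => x _; rewrite -subr_ge0.
  have -> : (1 + b / a) * `|S x| ^+ 2 + (1 + a / b) * `|T x| ^+ 2 -
      (`|S x| + `|T x|) ^+ 2 = (b * `|S x| - a * `|T x|) ^+ 2 / (a * b).
    by field; rewrite !gt_eqF.
  by rewrite mulr_ge0 ?sqr_ge0// invr_ge0 mulr_ge0 ?ltW.
rewrite big_split/= -!mulr_sumr.
have -> : (a + b) ^+ 2 = (1 + b / a) * a ^+ 2 + (1 + a / b) * b ^+ 2.
  by field; rewrite !gt_eqF.
by rewrite lerD// ler_wpM2l// addr_ge0// divr_ge0// ltW.
Qed.

Lemma hs_submod_closed : submod_closed hs_pred.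
Proof.
split=> [|a S T /hs_predP[Sl Sc Soo] /hs_predP[Tl Tc Too]]; apply/hs_predP.
  split; first by move=> a x y; rewrite scaler0 addr0.
    by move=> x; exact: cvg_cst.
  rewrite /hs_sqnorm esum1// => x _ /=.
  by rewrite /GRing.zero/= normr0 expr0n.
split.
- move=> k x y; have -> z : (a *: S + T) z = a *: S z + T z by [].
  rewrite Sl Tl !scalerDr !scalerA (mulrC a k) !addrA; congr (_ + _).
  by rewrite -!addrA; congr (_ + _); rewrite addrC.
- move=> x; apply: (@cvgD _ _ _ _ _ (a \*: S) T); last exact: Tc.
  by apply: cvgZr; exact: Sc.
- have [aSoo _] := hs_normZ_le a Soo.
  by have [] := hs_normD_le aSoo Too.
Qed.

HB.instance Definition _ :=
  GRing.isSubmodClosed.Build R (H -> H) hs_pred hs_submod_closed.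

Record hs := HS { hs_fun :> H -> H; _ : hs_fun \in hs_pred }.

HB.instance Definition _ := [isSub for hs_fun].
HB.instance Definition _ := [Choice of hs by <:].
HB.instance Definition _ := [SubChoice_isSubLmodule of hs by <:].

Lemma hsP (T : hs) : is_hs T.
Proof. by case: T => T /= /hs_predP. Qed.

Let norm (T : hs) : R := hs_norm T.

Let norm_normD (S T : hs) : norm (S + T) <= norm S + norm T.
Proof.
have [_ _ Soo] := hsP S; have [_ _ Too] := hsP T.
by have [] := hs_normD_le Soo Too.
Qed.

Let norm_normZ (a : R) (T : hs) : norm (a *: T) = `|a| * norm T.
Proof.
have le_norm b (S : hs) : norm (b *: S) <= `|b| * norm S.
  by have [_ _ Soo] := hsP S; have [] := hs_normZ_le b Soo.
apply/eqP; rewrite eq_le le_norm/=.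
have [->|a0] := eqVneq a 0; first by rewrite normr0 mul0r hs_norm_ge0.
by rewrite -ler_pdivlMl ?normr_gt0// -normfV -{1}[T](scalerK a0).
Qed.

Let norm_eq0 (T : hs) : norm T = 0 -> T = 0.
Proof.
move=> T0; have [Tl Tc Too] := hsP T.
have Te x : onb_set e x -> T x = 0.
  move=> ex; have := @hs_norm_ub T [:: x] Too erefl.
  rewrite big_seq1 -/(norm T) T0 expr0n/= => /(_ _)/le_trans Tx.
  apply/eqP; rewrite -normr_eq0 -sqrf_eq0 eq_le sqr_ge0 andbT.
  by apply: Tx => // y; rewrite inE => /eqP ->.
have Tspan x : linspan e x -> T x = 0.
  move=> [s [c [se ->]]]; elim: s se => [_|v s ih se].
    rewrite big_nil; have := Tl (-1) 0 0.
    by rewrite scaleN1r oppr0 addr0 scaleN1r addNr.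
  have ev : onb_set e v by apply: se; exact: mem_head.
  rewrite big_cons Tl Te// scaler0 add0r ih// => w ws.
  by apply: se; rewrite inE ws orbT.
apply/val_inj/funext => x /=; apply: contrapT => Tx.
have oT : open (T @^-1` [set~ 0]).
  by apply: open_comp => [y _|]; [exact: Tc|exact/closed_openC/accessible_closed_set1/hausdorff_accessible/norm_hausdorff].
by have [y [/= Ty /Tspan]] := @onb_total _ _ e _ (ex_intro _ x Tx) oT.
Qed.

HB.instance Definition _ :=
  Lmodule_isNormed.Build R hs norm_normD norm_normZ norm_eq0.

Lemma bessel x s : uniq s -> (forall y, y \in s -> onb_set e y) ->
  \sum_(y <- s) inner x y ^+ 2 <= `|x| ^+ 2.
Proof.
elim: s x => [x _ _|y s ih x /= /andP[ys us] se].
  by rewrite big_nil sqr_ge0.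
have ey : onb_set e y by apply: se; exact: mem_head.
have {}se z : z \in s -> onb_set e z.
  by move=> zs; apply: se; rewrite inE zs orbT.
rewrite big_cons -lerBrDl.
have -> : `|x| ^+ 2 - inner x y ^+ 2 = `|x - inner x y *: y| ^+ 2.
  rewrite sqnormB innerZr normrZ exprMn -normrX -(inner_sqnorm y).
  rewrite (onb_orthonormal ey ey) eqxx mulr1 ger0_norm ?sqr_ge0//; ring.
apply: le_trans (ih _ us se); rewrite big_seq [leRHS]big_seq.
apply: ler_sum => z zs; rewrite innerBl innerZl (onb_orthonormal ey (se _ zs)).
by rewrite (_ : y == z = false) ?mulr0 ?subr0//; apply: contraNF ys => /eqP->.
Qed.

Lemma tensor_is_hs f g : (fun h => inner f h *: g) \in hs_pred.
Proof.
have lin : linear (fun h : H => inner f h *: g).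
  by move=> a x y; rewrite innerDr innerZr scalerDl scalerA.
apply/hs_predP; split=> //.
- pose L : {linear H -> H} :=
    HB.pack (fun h : H => inner f h *: g) (GRing.isLinear.Build _ _ _ _ _ lin).
  apply: (@bounded_linear_continuous _ _ _ L); apply/linear_boundedP.
  near=> r => x /=; rewrite normrZ.
  rewrite (le_trans (ler_wpM2r _ (CauchySchwarz_inner _ _)))// mulrAC.
  by rewrite ler_wpM2r//; near: r; exact: nbhs_pinfty_ge.
- suff [] : (hs_sqnorm (fun h => inner f h *: g) < +oo)%E /\
      hs_norm (fun h => inner f h *: g) <= `|f| * `|g| by [].
  apply: hs_norm_le => [|s us se]; first by rewrite mulr_ge0.
  under eq_bigr do rewrite normrZ exprMn real_normK ?num_real//.
  by rewrite -mulr_suml exprMn ler_wpM2r ?sqr_ge0// bessel.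
Unshelve. all: by end_near. Qed.

Definition tensor f g : hs := HS (tensor_is_hs f g).

End hilbert_schmidt.

Lemma hs_normE (R : realType) (H : hilbertType R) (e : onb H) (T : hs e) :
  `|T| = hs_norm e T.
Proof. by []. Qed.

Section bochner.
Context d (Om : measurableType d) (R : realType) (E : normedModType R).
Variable mu : set Om -> \bar R.
Implicit Types (s F : Om -> E).

Definition simple_integrable s := finite_set (range s) /\
  forall v, measurable (s @^-1` [set v]) /\
    (v != 0 -> (mu (s @^-1` [set v]) < +oo)%E).

Definition simple_integral s : E :=
  \sum_(v \in range s) fine (mu (s @^-1` [set v])) *: v.

(* The integral of a nonnegative function in mathcomp-analysis is a supremum over
   simple functions below it, hence insensitive to non-measurability: the a.e.
   convergence clause (strong measurability of F) cannot be dropped. *)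
Definition is_bochner_integral F (I : E) := exists s : nat -> Om -> E,
  [/\ forall n, simple_integrable (s n),
      {ae mu, forall w, s n w @[n --> \oo] --> F w},
      (\int[mu]_w (`|F w - s n w|)%:E @[n --> \oo] --> 0)%E
    & simple_integral (s n) @[n --> \oo] --> I].

(* 0 if F is not Bochner integrable *)
Definition bochner_integral F : E := xget 0 (is_bochner_integral F).

End bochner.

Notation borel H := (g_sigma_algebraType (@open H)).

(* The integral of mathcomp-analysis is defined for any set function, so that
   P(. | E) and b(n) P(X \in n .) need not be packaged as measures. *)
Definition cond_prob d (Om : measurableType d) (R : realType)
    (P : set Om -> \bar R) (E : set Om) : set Om -> \bar R :=
  fun A => (fine (P (A `&` E)) / fine (P E))%:E.

Section regular_variation.
Context {R : realType}.

Definition regularly_varying_fun (b : R -> R) (rho : R) :=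
  measurable_fun (`]0, +oo[ : set R) b /\
  forall x : R, 0 < x -> b (t * x) / b t @[t --> +oo] --> x `^ rho.

Context {H : hilbertType R}.

Definition punctured : set H := [set~ 0].

Definition C0_test (f : H -> R) :=
  [/\ {within punctured, continuous f},
      exists M : R, forall x : H, x != 0 -> `|f x| <= M
    & exists2 r : R, 0 < r & forall x : H, x != 0 -> `|x| < r -> f x = 0].

(* A Borel measure on H \ {0} is encoded as the Borel measure on H that extends
   it by giving mass 0 to the origin. *)
Definition in_M0 (mu : {measure set (borel H) -> \bar R}) :=
  mu [set (0 : H)] = 0%E /\
  forall A : set (borel H), measurable A -> A `<=` punctured ->
    (exists2 r : R, 0 < r & forall x : H, A x -> r <= `|x|) -> (mu A < +oo)%E.

Definition M0_cvg (mu_ : nat -> set (borel H) -> \bar R)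
    (mu : set (borel H) -> \bar R) :=
  forall f, C0_test f ->
    (\int[mu_ n]_(x in punctured) (f x)%:E @[n --> \oo] -->
     \int[mu]_(x in punctured) (f x)%:E)%E.

Context d (Om : measurableType d) (P : probability Om R).
Variable X : {mfun Om >-> borel H}.

Definition dilation (t : R) (A : set H) : set H := [set t *: x | x in A].

Definition regularly_varying (alpha : R) :=
  exists (mu : {measure set (borel H) -> \bar R}) (b : R -> R) (rho : R),
  [/\ in_M0 mu,
      mu punctured <> 0%E,
      regularly_varying_fun b rho,
      M0_cvg (fun n A => (b n%:R)%:E * P (X @^-1` dilation n%:R A))%E mu
    & forall (t : R) (A : set (borel H)),
        0 < t -> measurable A -> A `<=` punctured ->
        mu (dilation t A) = ((t `^ (- alpha))%:E * mu A)%E].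

Definition radius (w : Om) : R := `|(X w : H)|.

(* Equal to 0 where X = 0, an event on which radius > t fails for t > 0. *)
Definition angle (w : Om) : H := `|(X w : H)|^-1 *: (X w : H).

Definition exceeds (t : R) : set Om := [set w | t < radius w].

Definition sphere : set H := [set x | `|x| = 1].

Definition angular_law (t : R) (A : set (borel H)) : \bar R :=
  cond_prob P (exceeds t) (angle @^-1` A).

(* Probability measures on the unit sphere are encoded as Borel probability
   measures on H that give full mass to the sphere. *)
Definition limit_angular_measure (Q : probability (borel H) R) :=
  Q sphere = 1%E /\
  forall f : H -> R, {within sphere, continuous f} ->
    (exists M : R, forall x : H, sphere x -> `|f x| <= M) ->
    (\int[angular_law t]_(x in sphere) (f x)%:E @[t --> +oo%R] -->
     \int[Q]_(x in sphere) (f x)%:E)%E.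

End regular_variation.

(* Main.v *)
From HB Require Import structures.
Require Import Defs.
From mathcomp Require Import all_boot all_order all_algebra.
From mathcomp Require Import all_classical all_reals all_analysis.
From mathcomp Require Import finmap measurable_realfun ring lra.

(* The map G x = x (x) x is continuous from H to HS(H) and bounded by 1 on the
   unit sphere, so only the weak convergence of the angular laws matters. Fix a
   dense sequence c in the range of G and cut a continuous partition of unity
   p_k out of bumps around the points c_k. For any law of an angle, the Bochner
   integral of G is within the integral of B = sum_k p_k |G - c_k| of the finite
   sum of the (integral of p_k) c_k. For the limit law the integral of B is made
   small by dominated convergence, and since B and the p_k are bounded and
   continuous on the sphere, their integrals under the conditional laws converge.
   The same estimate shows that the integrals of simple approximations form a
   Cauchy sequence; as HS(H) is complete, the Bochner integrals exist. *)

Set Implicit Arguments.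
Unset Strict Implicit.
Unset Printing Implicit Defensive.

Import Order.TTheory GRing.Theory Num.Theory numFieldNormedType.Exports.

Local Open Scope classical_set_scope.
Local Open Scope ring_scope.

(** * Completeness of the Hilbert-Schmidt operators *)

Section hs_theory.
Context {R : realType} {H : hilbertType R} (e : onb H).
Implicit Types (S T : hs e) (x y : H).

Lemma hs_fun_sum T (s : seq H) (c : H -> R) :
  T (\sum_(v <- s) c v *: v) = \sum_(v <- s) c v *: T v.
Proof.
have [Tl _ _] := hsP T.
elim: s => [|v s ih]; last by rewrite !big_cons Tl ih.
by rewrite !big_nil; have := Tl (-1) 0 0; rewrite !scaleN1r oppr0 addr0 addNr.
Qed.

Lemma hs_norm_tensor (f g : H) : `|tensor e f g| <= `|f| * `|g|.
Proof.
rewrite hs_normE; apply: (hs_norm_le _ _).2 => [|s us se]; first exact: mulr_ge0.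
under eq_bigr do rewrite /= normrZ exprMn real_normK ?num_real//.
by rewrite -mulr_suml exprMn ler_wpM2r ?sqr_ge0// (bessel f us se).
Qed.

(** Bilinearity of the tensor product; it reduces continuity of the diagonal [x] to [tensor e x x]
    to the bound of [hs_norm_tensor] on each summand. *)
Lemma tensorB (f g : H) :
  tensor e f f - tensor e g g = tensor e (f - g) f + tensor e g (f - g).
Proof.
apply/val_inj/funext => x.
change (inner f x *: f - inner g x *: g =
        inner (f - g) x *: f + inner g x *: (f - g)).
by rewrite innerBl scalerBl scalerBr addrA subrK.
Qed.

Lemma continuous_tensor_diag : continuous (fun x : H => tensor e x x).
Proof.
move=> x; apply/cvgrPdist_lt => eps eps0.
have dx : `|x - y| @[y --> x] --> (0 : R).
  rewrite -(normr0 H) -(subrr x); apply: cvg_norm.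
  by apply: (cvgB (cvg_cst _)); exact: cvg_id.
have cx : `|x - y| * `|x| + `|y| * `|x - y| @[y --> x] --> (0 : R).
  rewrite -[X in _ --> X]addr0; apply: cvgD.
    by rewrite -[X in _ --> X](mul0r `|x|); exact: cvgMl.
  rewrite -[X in _ --> X](mulr0 `|x|); apply: cvgM => //.
  exact: norm_continuous.
have /cvgr_lt/(_ _ eps0) := cx; apply: filterS => y; apply: le_lt_trans.
by rewrite tensorB (le_trans (ler_normD _ _))// lerD// hs_norm_tensor.
Qed.

(** The map [p] is the orthogonal projection onto the span of the list: it is linear and fixes each
    listed vector, hence every combination of them. Duplicates are removed first, since a repeated
    vector would be counted twice in [p]. *)
Lemma linspan_fourier x : linspan e x -> exists s : seq H,
  [/\ uniq s, forall v, v \in s -> onb_set e v &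
      x = \sum_(v <- s) inner x v *: v].
Proof.
move=> [s [c [se ->]]]; exists (undup s); split; first exact: undup_uniq.
  by move=> v; rewrite mem_undup => /se.
pose p (x : H) := \sum_(v <- undup s) inner x v *: v.
have pv v : v \in s -> p v = v.
  move=> vs; rewrite /p (bigD1_seq v) ?mem_undup ?undup_uniq//=.
  rewrite (onb_orthonormal (se _ vs) (se _ vs)) eqxx scale1r.
  rewrite big_seq_cond big1 ?addr0// => w /andP[]; rewrite mem_undup => ws wv.
  by rewrite (onb_orthonormal (se _ vs) (se _ ws)) eq_sym (negbTE wv) scale0r.
have pDZ a y z : p (a *: y + z) = a *: p y + p z.
  rewrite /p scaler_sumr -big_split/=; apply: eq_bigr => v _.
  by rewrite innerDl innerZl scalerDl scalerA.
rewrite -/(p _); have : {subset s <= s} by [].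
elim: {-2}s => [_|v t ih ts].
  by rewrite big_nil /p big1// => v _; rewrite inner0l scale0r.
rewrite big_cons pDZ -ih; first by rewrite pv// ts// mem_head.
by move=> w wt; rewrite ts// inE wt orbT.
Qed.

(** The Hilbert-Schmidt norm dominates the operator norm. On the span of the basis this is
    Cauchy-Schwarz applied to the Fourier expansion, with Bessel for the coefficients. It extends to
    all of [H] by density, because the set where it fails is open. *)
Lemma hs_fun_norm_le T x : `|T x| <= `|T| * `|x|.
Proof.
have [Tl Tc Too] := hsP T.
suff Tspan y : linspan e y -> `|T y| <= `|T| * `|y|.
  rewrite leNgt; apply/negP => Tx.
  pose A := [set y | `|T| * `|y| < `|T y|].
  have oA : open A.
    rewrite /A; under eq_set do rewrite -subr_gt0.
    apply: (@open_comp _ _ (fun y => `|T y| - `|T| * `|y|) [set z | 0 < z]).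
      move=> y _; apply: cvgB; first by apply: cvg_norm; exact: Tc.
      by apply: cvgMr; exact: norm_continuous.
    exact: open_gt.
  have [y [Ay /Tspan]] := @onb_total _ _ e A (ex_intro _ x Tx) oA.
  by rewrite leNgt Ay.
move=> /linspan_fourier[s [us se yE]].
have [->|T0] := eqVneq T 0; first by rewrite !normr0 mul0r.
have [y0|y0] := eqVneq y 0.
  by have := hs_fun_sum T [::] (fun=> 0); rewrite y0 !big_nil => ->; rewrite !normr0 mulr0.
have a0 : 0 < `|T| by rewrite normr_gt0.
have b0 : 0 < `|y| by rewrite normr_gt0.
have Ts : \sum_(v <- s) `|T v| ^+ 2 <= `|T| ^+ 2 by rewrite hs_normE hs_norm_ub.
have ys := bessel y us se.
rewrite [in T y]yE hs_fun_sum (le_trans (ler_norm_sum _ _ _))//.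
under eq_bigr do rewrite normrZ.
move: a0 b0 Ts ys; set a := `|T|; set b := `|y| => a0 b0 Ts ys.
(* AM-GM: [2 u v <= (a / b) u^2 + (b / a) v^2] *)
apply: (@le_trans _ _ (\sum_(v <- s) ((a / b / 2) * inner y v ^+ 2 +
    (b / a / 2) * `|T v| ^+ 2))).
  apply: ler_sum => v _; rewrite -subr_ge0 -(real_normK (num_real (inner y v))).
  have -> : a / b / 2 * `|inner y v| ^+ 2 + b / a / 2 * `|T v| ^+ 2 -
      `|inner y v| * `|T v| =
      (a * `|inner y v| - b * `|T v|) ^+ 2 / (2 * a * b).
    by field; rewrite !gt_eqF.
  by rewrite mulr_ge0 ?sqr_ge0// invr_ge0 !mulr_ge0// ltW.
rewrite big_split/= -!mulr_sumr.
have -> : a * b = a / b / 2 * b ^+ 2 + b / a / 2 * a ^+ 2.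
  by field; rewrite !gt_eqF.
by rewrite lerD// ler_wpM2l// !mulr_ge0// ?invr_ge0 ltW.
Qed.

(** By [hs_fun_norm_le], a Cauchy filter of operators is Cauchy at each point, which yields a
    pointwise limit [L]. Bounds on finite sums over the basis survive the pointwise limit, and this
    turns pointwise convergence into convergence in norm. *)
Lemma hs_complete (F : set_system (hs e)) :
  ProperFilter F -> cauchy F -> cvg F.
Proof.
move=> FF Fc.
have cF eps : 0 < eps -> \forall T \near F, \forall S \near F, `|T - S| < eps.
  move=> eps0; have /cauchy_ballP/(_ _ eps0) := Fc.
  by move=> /nearP_dep; apply: filterS => T; apply: filterS => S; rewrite -ball_normE.
have cx x : cvg ((fun T : hs e => T x) @ F).
  apply: cauchy_cvg; apply/cauchy_exP => eps eps0.
  (* The added 1 keeps the divisor positive when [x] is 0. *)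
  have dx : 0 < `|x| + 1 by rewrite ltr_wpDl.
  have [T TF] := filter_ex (cF _ (divr_gt0 eps0 dx)).
  exists (T x); apply: filterS TF => S /ltW TS.
  rewrite -ball_normE /=.
  change (`|(T - S) x| < eps).
  rewrite (le_lt_trans (hs_fun_norm_le _ _))//.
  rewrite (le_lt_trans (ler_wpM2r _ TS))//.
  by rewrite mulrAC ltr_pdivrMr// ltr_pM2l// ltrDl.
pose L x := lim ((fun T : hs e => T x) @ F).
have LE x : (fun T : hs e => T x) @ F --> L x by exact: cx.
have Llin : linear L.
  move=> a x y; apply: cvg_lim; first exact: norm_hausdorff.
  have -> : (fun T : hs e => T (a *: x + y)) = (fun T : hs e => a *: T x + T y).
    by apply/funext => T; have [-> _ _] := hsP T.
  by apply: cvgD; [apply: cvgZr|]; exact: LE.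
have TL eps T : 0 < eps -> (\forall S \near F, `|T - S| < eps) ->
    exists2 D : hs e, hs_fun D = (T \- L) & `|D| <= eps.
  move=> eps0 TF.
  have Dx x : `|T x - L x| <= eps * `|x|.
    have cD : `|T x - (S : hs e) x| @[S --> F] --> `|T x - L x|.
      by apply: cvg_norm; apply: cvgB; [exact: cvg_cst|exact: LE].
    rewrite -(cvg_lim _ cD)//; apply: limr_le; first by apply/cvg_ex; exists `|T x - L x|.
    apply: filterS TF => S /ltW TS.
    by rewrite (le_trans (hs_fun_norm_le (T - S) x))// ler_wpM2r.
  have Dlin : linear (T \- L : H -> H).
    move=> a x y; have [Tl _ _] := hsP T.
    by rewrite /= Llin Tl scalerBr opprD addrACA.
  have [Doo Dle] : (hs_sqnorm e (T \- L)%R < +oo)%E /\ hs_norm e (T \- L) <= eps.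
    apply: hs_norm_le => [|s us se]; first exact: ltW.
    have cD : \sum_(v <- s) `|T v - (S : hs e) v| ^+ 2 @[S --> F] -->
        \sum_(v <- s) `|T v - L v| ^+ 2.
      apply: cvg_big => [|v _]; first exact: add_continuous.
      apply: (@cvg_comp _ _ _ _ (fun z : R => z ^+ 2)); last exact: exprn_continuous.
      by apply: cvg_norm; apply: cvgB; [exact: cvg_cst|exact: LE].
    rewrite -(cvg_lim _ cD)//; apply: limr_le.
      by apply/cvg_ex; exists (\sum_(v <- s) `|T v - L v| ^+ 2).
    apply: filterS TF => S /ltW TS; have [_ _ TSoo] := hsP (T - S).
    rewrite (le_trans (hs_norm_ub TSoo us se))// -hs_normE.
    by rewrite ler_pXn2r// nnegrE// ltW.
  have Dhs : (T \- L : H -> H) \in hs_pred e.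
    apply/hs_predP; split => //.
    pose D : {linear H -> H} :=
      HB.pack (T \- L : H -> H) (GRing.isLinear.Build _ _ _ _ _ Dlin).
    apply: (@bounded_linear_continuous _ _ _ D); apply/linear_boundedP.
    exists eps; split; first exact: num_real.
    by move=> r /ltW er x /=; rewrite (le_trans (Dx x))// ler_wpM2r.
  by exists (HS Dhs) => //; rewrite hs_normE.
(* [L] is so far a bare function. Since [D0] packages the difference of [T0] and [L] as a
   Hilbert-Schmidt operator, [T0 - D0] is an element of [hs e] with the values of [L]. *)
have [T0 T0F] := filter_ex (cF 1 ltr01).
have [D0 D0E _] := TL _ _ ltr01 T0F.
have LEE x : (T0 - D0) x = L x.
  change (T0 x - D0 x = L x); rewrite D0E /=.
  by rewrite opprB addrC subrK.
apply/cvg_ex; exists (T0 - D0); apply/cvgrPdist_le => eps eps0.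
have := cF _ eps0; apply: filterS => T /(TL _ _ eps0)[D DE Deps].
rewrite distrC (_ : T - (T0 - D0) = D)//.
apply/val_inj/funext => x.
change (T x - (T0 - D0) x = D x).
by rewrite LEE DE.
Qed.

HB.instance Definition _ := Uniform_isComplete.Build (hs e) hs_complete.

End hs_theory.

(** * Bochner integrals *)

Section simple.
Context d (Om : measurableType d) (R : realType) (E : normedModType R).
Variable mu : {finite_measure set Om -> \bar R}.
Implicit Types (s F : Om -> E).

(** [E] carries no sigma-algebra here. On each of the finitely many level sets of [s] the first
    argument of [g] is constant, so measurability of the single functions [g v] suffices. *)
Lemma measurable_fun_simple_comp s (g : E -> Om -> R) :
  simple_integrable mu s -> (forall v, measurable_fun setT (g v)) ->
  measurable_fun setT (fun w => g (s w) w).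
Proof.
move=> [fs ms] mg _ B mB; rewrite setTI.
have -> : (fun w => g (s w) w) @^-1` B =
    \bigcup_(v in range s) (s @^-1` [set v] `&` g v @^-1` B).
  apply/seteqP; split => [w /= Bw|w [v _ [/= <-]]//].
  by exists (s w) => //; exists w.
apply: fin_bigcup_measurable => // v _; apply: measurableI.
  by have [] := ms v.
by rewrite -[X in measurable X]setTI; exact: mg.
Qed.

Context (n : nat) (p : 'I_n -> Om -> R).
Hypotheses (mp : forall k, measurable_fun setT (p k)) (p0 : forall k w, 0 <= p k w)
  (p1 : forall w, \sum_(k < n) p k w = 1).

Let ple1 k w : p k w <= 1.
Proof. by rewrite -(p1 w) (bigD1 k)//= lerDl sumr_ge0. Qed.

Let intp_fin k A : measurable A -> (\int[mu]_(w in A) (p k w)%:E)%E \is a fin_num.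
Proof.
move=> mA; rewrite ge0_fin_numE; last first.
  by apply: integral_ge0 => w _; rewrite lee_fin.
apply: (@le_lt_trans _ _ (\int[mu]_(w in A) 1)%E).
  apply: ge0_le_integral => //.
  - by move=> w _; rewrite lee_fin.
  - by apply/measurable_EFinP; exact: measurable_funS (mp k).
  - by move=> w _; rewrite lee_fin.
by rewrite integral_cst// mul1e ltey_eq fin_num_measure.
Qed.

(** All three quantities are finite double sums with the same weights [m v k]: of [v] for the simple
    integral, of [c k] for the combination of centers, and of the norm of [v - c k] for the bound.
    The triangle inequality concludes. *)
Lemma dist_simple_integral s (c : 'I_n -> E) : simple_integrable mu s ->
  (`|simple_integral mu s - \sum_(k < n) (\int[mu]_w p k w) *: c k|%:E <=
   \int[mu]_w (\sum_(k < n) p k w * `|s w - c k|)%:E)%E.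
Proof.
move=> ss; have [fs ms] := ss.
pose A v := s @^-1` [set v]; pose V : seq E := fset_set (range s).
have mA v : measurable (A v) by have [] := ms v.
have intA (f : Om -> R) : measurable_fun setT f -> (forall w, 0 <= f w) ->
    (\int[mu]_w (f w)%:E = \sum_(v <- V) \int[mu]_(w in A v) (f w)%:E)%E.
  move=> mf f0.
  have AT : \big[setU/set0]_(v <- V) A v = setT.
    apply/seteqP; split => // w _; rewrite -bigcup_seq; exists (s w) => //=.
    by rewrite in_fset_set// mem_set//; exists w.
  rewrite -AT; apply: ge0_integral_bigsetU => //.
  - exact: fset_uniq.
  - by move=> u v _ _ [w [/= <- <-]].
  - by rewrite AT; exact/measurable_EFinP.
  - by move=> w _; rewrite lee_fin.
pose m v k := \int[mu]_(w in A v) p k w.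
have mE v k : (m v k)%:E = (\int[mu]_(w in A v) (p k w)%:E)%E by rewrite fineK// intp_fin.
have m0 v k : 0 <= m v k by apply: Rintegral_ge0.
(* The identity [p1] integrated over the level set [A v]. *)
have muA v : fine (mu (A v)) = \sum_(k < n) m v k.
  apply: EFin_inj; rewrite fineK ?fin_num_measure// -[LHS]mul1e -integral_cst//.
  rewrite -sumEFin; under [RHS]eq_bigr do rewrite mE.
  rewrite -ge0_integral_sum//.
  - by apply: eq_integral => w _; rewrite sumEFin p1.
  - by move=> k; apply/measurable_EFinP; exact: measurable_funS (mp k).
  - by move=> k w _; rewrite lee_fin.
have intp k : \int[mu]_w p k w = \sum_(v <- V) m v k.
  apply: EFin_inj; rewrite fineK ?intp_fin// intA// -sumEFin.
  by apply: eq_bigr => v _; rewrite mE.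
have -> : (\int[mu]_w (\sum_(k < n) p k w * `|s w - c k|)%:E =
    (\sum_(v <- V) \sum_(k < n) m v k * `|v - c k|)%:E)%E.
  rewrite intA; last 2 first.
  - apply: (@measurable_fun_simple_comp s
      (fun v w => \sum_(k < n) p k w * `|v - c k|)) => // v.
    by apply: measurable_sum => k; apply: measurable_funM.
  - by move=> w; apply: sumr_ge0 => k _; rewrite mulr_ge0.
  rewrite -sumEFin; apply: eq_bigr => v _.
  transitivity (\int[mu]_(w in A v) \sum_(k < n) ((p k w)%:E * `|v - c k|%:E))%E.
    by apply: eq_integral => w /set_mem /= <-; rewrite -sumEFin.
  have mpA k : measurable_fun (A v) (fun w => (p k w)%:E).
    by apply/measurable_EFinP; exact: measurable_funS (mp k).
  rewrite ge0_integral_sum//.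
  - rewrite -sumEFin; apply: eq_bigr => k _.
    by rewrite EFinM mE ge0_integralZr// => w _; rewrite lee_fin.
  - by move=> k; apply: emeasurable_funM.
  - by move=> k w _; rewrite mule_ge0// lee_fin.
rewrite lee_fin /simple_integral fsbig_finite//= -/V.
under eq_bigr do rewrite -/(A _) muA scaler_suml.
under [X in _ - X]eq_bigr do rewrite intp scaler_suml.
rewrite [X in _ - X]exchange_big/= -sumrB (le_trans (ler_norm_sum _ _ _))//.
apply: ler_sum => v _; rewrite -sumrB (le_trans (ler_norm_sum _ _ _))//.
by apply: ler_sum => k _; rewrite -scalerBr normrZ ger0_norm.
Qed.

(** The triangle inequality through [F w], averaged over [k] with the weights [p k w], which sum to
    1. *)
Lemma dist_simple_integral_approx s F (c : 'I_n -> E) :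
  simple_integrable mu s ->
  (forall v, measurable_fun setT (fun w => `|F w - v|)) ->
  (`|simple_integral mu s - \sum_(k < n) (\int[mu]_w p k w) *: c k|%:E <=
   \int[mu]_w `|F w - s w|%:E +
   \int[mu]_w (\sum_(k < n) p k w * `|F w - c k|)%:E)%E.
Proof.
move=> ss mF.
have mFs : measurable_fun setT (fun w => `|F w - s w|).
  exact: (@measurable_fun_simple_comp s (fun v w => `|F w - v|)).
apply: (le_trans (dist_simple_integral c ss)).
rewrite -ge0_integralD//; last 3 first.
- exact/measurable_EFinP.
- by move=> w _; rewrite lee_fin sumr_ge0// => k _; rewrite mulr_ge0.
- by apply/measurable_EFinP/measurable_sum => k; apply: measurable_funM.
apply: ge0_le_integral => //.
- by move=> w _; rewrite lee_fin sumr_ge0// => k _; rewrite mulr_ge0.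
- apply/measurable_EFinP/(@measurable_fun_simple_comp s
    (fun v w => \sum_(k < n) p k w * `|v - c k|)) => // v.
  by apply: measurable_sum => k; apply: measurable_funM.
- apply: emeasurable_funD; first exact/measurable_EFinP.
  by apply/measurable_EFinP/measurable_sum => k; apply: measurable_funM.
move=> w _; rewrite lee_fin -[X in _ <= X + _]mul1r -(p1 w) mulr_suml.
rewrite -big_split/=; apply: ler_sum => k _.
by rewrite -mulrDr ler_wpM2l// (distrC (F w) (s w)) ler_distD.
Qed.

(** Limit of the preceding estimate along the approximating sequence: the error term [F - s m] tends
    to 0 in mean. *)
Lemma dist_bochner_integral F I (c : 'I_n -> E) :
  (forall v, measurable_fun setT (fun w => `|F w - v|)) ->
  is_bochner_integral mu F I ->
  (`|I - \sum_(k < n) (\int[mu]_w p k w) *: c k|%:E <=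
   \int[mu]_w (\sum_(k < n) p k w * `|F w - c k|)%:E)%E.
Proof.
move=> mF [s [ss _ sF sI]].
set J := \sum_(k < n) _ *: _; set B := (\int[mu]_w _)%E.
have le_n m : (`|simple_integral mu (s m) - J|%:E <=
    \int[mu]_w `|F w - s m w|%:E + B)%E by exact: dist_simple_integral_approx.
have cl : `|simple_integral mu (s m) - J|%:E @[m --> \oo] --> `|I - J|%:E.
  apply: cvg_EFin; first exact: nearW.
  by apply: cvg_norm; apply: cvgB => //; exact: cvg_cst.
have cr : (\int[mu]_w `|F w - s m w|%:E + B @[m --> \oo] --> 0 + B)%E.
  by apply: cvgeD => //; exact: cvg_cst.
by rewrite -[B]add0e; apply: (lee_cvg_to cl cr); exact: nearW.
Qed.

End simple.

(** * Continuous partitions of unity around a sequence of centers *)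

Section partition_of_unity.
Context {R : realType} {E : normedModType R} (c : nat -> E) (del : R).
Implicit Types (y : E).

(** For positive [del], a piecewise linear cutoff: 1 within distance [del] of [c n], and 0 from
    distance [2 * del] on. *)
Definition bump n y : R :=
  Num.min 1 (Num.max 0 (2 - `|y - c n| / del)).

(** Mass left over by the first [n] bumps. The successive decrements [uncovered k y * bump k y]
    telescope, which makes them the weights of a partition of unity. *)
Fixpoint uncovered n y : R :=
  if n is m.+1 then uncovered m y * (1 - bump m y) else 1.

Lemma bump_ge0 n y : 0 <= bump n y.
Proof. by rewrite le_min ler01 le_max lexx. Qed.

Lemma bump_le1 n y : bump n y <= 1.
Proof. by rewrite ge_min lexx. Qed.

Lemma uncovered_ge0 n y : 0 <= uncovered n y.
Proof.
by elim: n => //= n ih; rewrite mulr_ge0// subr_ge0 bump_le1.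
Qed.

Lemma uncovered_le1 n y : uncovered n y <= 1.
Proof.
elim: n => //= n ih; rewrite mulr_ile1 ?uncovered_ge0 ?subr_ge0 ?bump_le1//.
by rewrite gerBl bump_ge0.
Qed.

Hypothesis del0 : 0 < del.

Lemma bump_dist_le n y : bump n y * `|y - c n| <= bump n y * (2 * del).
Proof.
have [yc|yc] := leP `|y - c n| (2 * del); first by rewrite ler_wpM2l// bump_ge0.
suff -> : bump n y = 0 by rewrite !mul0r.
rewrite /bump max_l ?min_r//.
by rewrite subr_le0 ler_pdivlMr// ltW.
Qed.

Lemma uncovered_eq0 n y : (exists2 k, (k < n)%N & `|y - c k| <= del) ->
  uncovered n y = 0.
Proof.
move=> [k + yc]; elim: n => //= n ih; rewrite ltnS leq_eqVlt => /predU1P[<-|/ih->].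
  suff -> : bump k y = 1 by rewrite subrr mulr0.
  apply/min_l; rewrite le_max; apply/orP; right.
  have : `|y - c k| / del <= 1 by rewrite ler_pdivrMr// mul1r.
  by move=> ?; lra.
by rewrite mul0r.
Qed.

Lemma continuous_bump n : continuous (bump n).
Proof.
move=> y; apply: (@continuous_min R E (cst 1)
  (fun y => Num.max 0 (2 - `|y - c n| / del)) y); first exact: cvg_cst.
apply: (@continuous_max R E (cst 0) (fun y => 2 - `|y - c n| / del) y).
  exact: cvg_cst.
apply: cvgB; first exact: cvg_cst.
apply: cvgMl; apply: (@cvg_norm _ E); apply: cvgB; last exact: cvg_cst.
exact: cvg_id.
Qed.

Lemma continuous_uncovered n : continuous (uncovered n).
Proof.
elim: n => [|n ih] y /=; first exact: cvg_cst.
apply: cvgM; first exact: ih.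
by apply: cvgB; [exact: cvg_cst|exact: continuous_bump].
Qed.

(** Measurability of [F] is expressed through its distances to fixed points, and each [bump] depends
    on its argument only through such a distance. *)
Lemma measurable_uncovered d (Om : measurableType d) (F : Om -> E) n :
  (forall v, measurable_fun setT (fun w => `|F w - v|)) ->
  measurable_fun setT (fun w => uncovered n (F w)).
Proof.
move=> mF; elim: n => [|n ih] /=; first exact: measurable_cst.
apply: measurable_funM => //; apply: measurable_funB; first exact: measurable_cst.
apply: measurable_minr; first exact: measurable_cst.
apply: measurable_maxr; first exact: measurable_cst.
apply: measurable_funB; first exact: measurable_cst.
by apply: measurable_funM => //; exact: measurable_cst.
Qed.

(* The part not covered by the first [n] bumps is attached to the center [0]. *)
Definition punity n (k : 'I_n.+1) y : R :=
  if (k < n)%N then uncovered k y - uncovered k.+1 y else uncovered n y.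

Definition pcenter n (k : 'I_n.+1) : E := if (k < n)%N then c k else 0.

Lemma punity_ge0 n (k : 'I_n.+1) y : 0 <= punity k y.
Proof.
rewrite /punity; case: ifP => _; last exact: uncovered_ge0.
by rewrite subr_ge0 /= ler_piMr ?uncovered_ge0// gerBl bump_ge0.
Qed.

Lemma punity_sum1 n y : \sum_(k < n.+1) punity k y = 1.
Proof.
rewrite big_ord_recr /= /punity ltnn.
under eq_bigr => k _ do rewrite /= ltn_ord.
rewrite -(big_mkord xpredT (fun k => uncovered k y - uncovered k.+1 y)).
rewrite (telescope_sumr_eq (fun k => - uncovered k y))//=.
  by rewrite opprK addrAC addNr add0r.
by move=> k _; rewrite opprK addrC.
Qed.

Lemma continuous_punity n (k : 'I_n.+1) : continuous (punity k).
Proof.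
rewrite /punity; case: (k < n)%N => y; last exact: continuous_uncovered.
by apply: cvgB; exact: continuous_uncovered.
Qed.

Lemma measurable_punity d (Om : measurableType d) (F : Om -> E) n (k : 'I_n.+1) :
  (forall v, measurable_fun setT (fun w => `|F w - v|)) ->
  measurable_fun setT (fun w => punity k (F w)).
Proof.
move=> mF; rewrite /punity; case: (k < n)%N; last exact: measurable_uncovered.
by apply: measurable_funB; exact: measurable_uncovered.
Qed.

(** For [k < n] the weight contains the factor [bump k y], which vanishes farther than [2 * del]
    from [c k]. The last weight has center 0 and contributes [uncovered n y] times the norm of
    [y]. *)
Lemma punity_dist_le n y :
  \sum_(k < n.+1) punity k y * `|y - pcenter k| <= 2 * del + uncovered n y * `|y|.
Proof.
rewrite big_ord_recr /= /punity /pcenter ltnn subr0 lerD2r.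
(* The constant 1 is expanded as the sum of all weights, so that the two sides can be compared term
   by term. *)
rewrite -[leRHS]mul1r -[X in X * (2 * _)](punity_sum1 n y) big_ord_recr/= mulrDl mulr_suml.
apply: ler_wpDr; first by rewrite mulr_ge0 ?punity_ge0// mulr_ge0// ltW.
apply: ler_sum => k _; rewrite /punity /= ltn_ord/=.
have -> : uncovered k y - uncovered k y * (1 - bump k y) =
  uncovered k y * bump k y by ring.
by rewrite -!mulrA ler_wpM2l ?uncovered_ge0// bump_dist_le.
Qed.

End partition_of_unity.

(** * Partitions of unity with small mean distance to the centers *)

Section bochner_theory.
Context d (Om : measurableType d) (R : realType) (E : normedModType R).
Variables (mu : {finite_measure set Om -> \bar R}) (c : nat -> E) (F : Om -> E).
Hypotheses (mF : forall v, measurable_fun setT (fun w => `|F w - v|))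
  (cF : forall w, closure (range c) (F w))
  (iF : (\int[mu]_w `|F w|%:E < +oo)%E).

Let mnF : measurable_fun setT (fun w => `|F w|).
Proof. by have := mF 0; under eq_fun do rewrite subr0. Qed.

Lemma integrable_norm : mu.-integrable setT (fun w => `|F w|%:E).
Proof.
apply/integrableP; split; first exact/measurable_EFinP.
by under eq_integral do rewrite abse_EFin normr_id.
Qed.

Let cF_near w eps : 0 < eps -> exists k, `|F w - c k| < eps.
Proof.
move=> eps0; have [_ [[k _ <-]]] := cF (nbhsx_ballx (F w) eps eps0).
by rewrite -ball_normE; exists k.
Qed.

(** Each [F w] lies within [del] of some [c k], so the integrand is 0 from [n = k + 1] on; the norm
    of [F] dominates it. *)
Lemma cvg_integral_uncovered del : 0 < del ->
  (\int[mu]_w (uncovered c del n (F w) * `|F w|)%:E @[n --> \oo] --> 0)%E.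
Proof.
move=> del0.
have [] := @dominated_convergence _ _ _ mu setT measurableT
  (fun n w => (uncovered c del n (F w) * `|F w|)%:E) (cst 0%E)
  (fun w => `|F w|%:E).
- move=> n; apply/measurable_EFinP; apply: measurable_funM => //.
  exact: measurable_uncovered.
- exact: measurable_cst.
- apply: aeW => w _; have [k Fk] := cF_near w del0.
  apply: cvg_near_cst; exists k.+1 => // n /= kn.
  by rewrite (uncovered_eq0 del0) ?mul0r//; exists k => //; exact: ltW.
- exact: integrable_norm.
- apply: aeW => w n _; rewrite abse_EFin lee_fin normrM normr_id.
  by rewrite ler_piMl// ger0_norm ?uncovered_ge0 ?uncovered_le1.
by rewrite integral0.
Qed.

Lemma exists_punity eps : 0 < eps -> exists del n,
  [/\ 0 < del, 2 * del <= eps &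
   (\int[mu]_w (\sum_(k < n.+1) punity c del k (F w) * `|F w - pcenter c k|)%:E
    <= eps%:E)%E].
Proof.
move=> eps0.
(* This makes both [del] and [del] times the total mass at most [eps / 4]; the added 1 keeps the
   denominator positive when [mu] is null. The constant term then costs at most [eps / 2], and the
   uncovered part the other half. *)
pose del := eps / (4 * (fine (mu setT) + 1)).
have M0 : 0 <= fine (mu setT) by rewrite fine_ge0.
have del0 : 0 < del by rewrite divr_gt0// mulr_gt0// ltr_wpDl.
have delM : del * fine (mu setT) <= eps / 4.
  rewrite /del mulrAC ler_pdivrMr; last by rewrite mulr_gt0// ltr_wpDl.
  by nra.
have del2 : del <= eps / 4.
  by rewrite /del ler_pdivrMr; [nra|rewrite mulr_gt0// ltr_wpDl].
have eps2 : (0%:E < (eps / 2)%:E)%E by rewrite lte_fin divr_gt0.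
have := cvg_integral_uncovered del0.
move=> /(_ _ (open_ereal_lt' eps2))[n _ /(_ n (leqnn n))/ltW/= un].
exists del, n; split => //; first by lra.
have -> : eps%:E = ((eps / 2)%:E + (eps / 2)%:E)%E by rewrite -EFinD -splitr.
apply: le_trans (leeD2l _ un).
apply: (@le_trans _ _ (\int[mu]_w ((2 * del)%:E +
    (uncovered c del n (F w) * `|F w|)%:E))%E).
  apply: ge0_le_integral => //.
  - move=> w _; rewrite lee_fin sumr_ge0// => k _.
    by rewrite mulr_ge0// punity_ge0.
  - apply/measurable_EFinP/measurable_sum => k; apply: measurable_funM => //.
    exact: measurable_punity.
  - apply/measurable_EFinP/measurable_funD => //; apply: measurable_funM => //.
    exact: measurable_uncovered.
  - by move=> w _; rewrite lee_fin punity_dist_le.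
rewrite ge0_integralD//; last 3 first.
- by move=> w _; rewrite lee_fin mulr_ge0// ltW.
- by move=> w _; rewrite lee_fin mulr_ge0// uncovered_ge0.
- apply/measurable_EFinP/measurable_funM => //; exact: measurable_uncovered.
apply: leeD2r; rewrite integral_cst//.
apply: (@le_trans _ _ (2 * del * fine (mu setT))%:E).
  by rewrite [leRHS]EFinM fineK// fin_num_measure.
by rewrite lee_fin; lra.
Qed.

End bochner_theory.

(** * Simple approximation by nearest points, and existence of the Bochner integral *)

Section nearest.
Context {R : realType} {E : normedModType R} (c : nat -> E).
Implicit Types (y : E).

(* A point closest to [y] among [0, c 0, ..., c (n - 1)]. *)
Fixpoint nearest n y : E :=
  if n is m.+1 then
    if `|y - c m| < `|y - nearest m y| then c m else nearest m y
  else 0.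

Lemma nearest_dist_nincr m n y : (m <= n)%N ->
  `|y - nearest n y| <= `|y - nearest m y|.
Proof.
move=> /subnK <-; elim: (n - m)%N => //= k ih.
by case: ifP => // /ltW; move/le_trans; exact.
Qed.

Lemma nearest_dist_norm n y : `|y - nearest n y| <= `|y|.
Proof. by have := nearest_dist_nincr y (leq0n n); rewrite subr0. Qed.

Lemma nearest_dist_le k n y : (k < n)%N -> `|y - nearest n y| <= `|y - c k|.
Proof.
move=> /nearest_dist_nincr /le_trans -> //=.
by case: ltP.
Qed.

Lemma cvg_nearest y : closure (range c) y -> nearest n y @[n --> \oo] --> y.
Proof.
move=> cy; apply/cvgrPdist_lt => eps eps0.
have [_ [[k _ <-]]] := cy _ (nbhsx_ballx y eps eps0).
rewrite -ball_normE => yk; exists k.+1 => // n /= kn.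
exact: le_lt_trans (nearest_dist_le y kn) yk.
Qed.

(** By induction: a level set at the next stage is cut along the set [B] where the new point is
    strictly closer, and [B] is measurable because the previous stage is simple. *)
Lemma simple_integrable_nearest d (Om : measurableType d)
    (mu : {finite_measure set Om -> \bar R}) (F : Om -> E) n :
  (forall v, measurable_fun setT (fun w => `|F w - v|)) ->
  simple_integrable mu (fun w => nearest n (F w)).
Proof.
move=> mF.
have finite_meas s : finite_set (range s) ->
    (forall v : E, measurable (s @^-1` [set v])) -> simple_integrable mu s.
  move=> fs ms; split => // v; split; first exact: ms.
  by move=> _; rewrite ltey_eq fin_num_measure.
elim: n => [|n ih]; apply: finite_meas => /=.
- by apply: (@sub_finite_set _ _ [set 0]) => // _ [w _ <-].
- by move=> v; rewrite preimage_cst; case: ifP.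
- case: ih => fn _; apply: (@sub_finite_set _ _ (c n |` range (fun w => nearest n (F w)))).
    by move=> _ [w _ <-]; case: ifP => _; [left|right; exists w].
  by rewrite finite_setU.
- move=> v; pose B := [set w | `|F w - c n| < `|F w - nearest n (F w)|].
  have mB : measurable B.
    have mn : measurable_fun setT (fun w => `|F w - nearest n (F w)|).
      exact: (measurable_fun_simple_comp (g := fun v w => `|F w - v|) ih).
    by rewrite -[B]setTI; exact: (measurable_fun_ltr (mF (c n)) mn).
  have [_ /(_ v)[mv _]] := ih.
  have -> : (fun w => if `|F w - c n| < `|F w - nearest n (F w)| then c n
      else nearest n (F w)) @^-1` [set v] =
      (B `&` [set _ | c n = v]) `|` ((fun w => nearest n (F w)) @^-1` [set v] `\` B).
    apply/seteqP; split => w /=; rewrite /B/=.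
      by case: ifPn => h; [left|right; split => //; exact/negP].
    by case => [[-> ]|[? /negP/negbTE ->]].
  apply: measurableU; last exact: measurableD.
  apply: measurableI => //.
  have -> : [set _ : Om | c n = v] = if c n == v then setT else set0.
    by case: eqP => cv; apply/seteqP; split.
  by case: ifP.
Qed.

End nearest.

(** The nearest-point maps approximate [F] in mean by dominated convergence, 0 being always among
    the candidates. Their integrals are Cauchy since, for each [eps], they all end up within [eps]
    of one finite combination of centers. *)
Lemma bochner_integral_exists d (Om : measurableType d) (R : realType)
    (E : completeNormedModType R) (mu : {finite_measure set Om -> \bar R})
    (c : nat -> E) (F : Om -> E) :
  (forall v, measurable_fun setT (fun w => `|F w - v|)) ->
  (forall w, closure (range c) (F w)) ->
  (\int[mu]_w `|F w|%:E < +oo)%E ->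
  exists I, is_bochner_integral mu F I.
Proof.
move=> mF cF iF; pose s n w := nearest c n (F w).
have ss n : simple_integrable mu (s n) by exact: simple_integrable_nearest.
have sF w : s n w @[n --> \oo] --> F w by exact: cvg_nearest.
have isF : (\int[mu]_w `|F w - s n w|%:E @[n --> \oo] --> 0)%E.
  have [] := @dominated_convergence _ _ _ mu setT measurableT
    (fun n w => `|F w - s n w|%:E) (cst 0%E) (fun w => `|F w|%:E).
  - move=> n; apply/measurable_EFinP.
    exact: (measurable_fun_simple_comp (g := fun v w => `|F w - v|) (ss n)).
  - exact: measurable_cst.
  - apply: aeW => w _; apply: cvg_EFin; first exact: nearW.
    rewrite -(normr0 E) -(subrr (F w)).
    by apply: cvg_norm; apply: (cvgB (cvg_cst _)); exact: sF.
  - exact: integrable_norm.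
  - by apply: aeW => w n _; rewrite abse_EFin normr_id lee_fin nearest_dist_norm.
  by rewrite integral0.
suff /cvg_ex[I sI] : cvg (simple_integral mu (s n) @[n --> \oo]).
  by exists I, s; split => //; exact: aeW.
apply: cauchy_cvg; apply/cauchy_exP => eps eps0.
have eps2 : 0 < eps / 2 by rewrite divr_gt0.
have [del [n [del0 _ Fn]]] := exists_punity mF cF iF eps2.
exists (\sum_(k < n.+1) (\int[mu]_w punity c del k (F w)) *: pcenter c k).
have eps2E : (0%:E < (eps / 2)%:E)%E by rewrite lte_fin.
have [N _ sN] := isF _ (open_ereal_lt' eps2E).
exists N => // m /= /sN /= sm; rewrite -ball_normE /= distrC -lte_fin.
apply: le_lt_trans.
  apply: (@dist_simple_integral_approx _ _ _ _ mu _ (fun k w => punity c del k (F w))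
    _ _ _ (s m) F (@pcenter _ _ c n) (ss m) mF).
  - by move=> k; exact: measurable_punity.
  - by move=> k w; exact: punity_ge0.
  - by move=> w; exact: punity_sum1.
by rewrite (splitr eps) EFinD (le_lt_trans (leeD2l _ Fn))// lteD2rE.
Qed.

(** * Angular laws *)

Section separable_range.
Context {R : realType} {T : topologicalType} {E : topologicalType}.

(** An injection of the dense set into the naturals is inverted; indices outside its image receive
    the default [x0]. *)
Lemma separable_dense_seq (x0 : T) : separable T ->
  exists u : nat -> T, forall x, closure (range u) x.
Proof.
move=> [D /countable_injP[f finj] dD].
pose u n := xget x0 [set x | D x /\ f x = n].
exists u => x B Bx.
have [y [By Dy]] := dD _ (ex_intro _ x (nbhs_singleton (nbhs_interior Bx)))
  (@open_interior _ B).
exists y; split; last exact: interior_subset.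
exists (f y) => //.
have [Du uf] : [set x | D x /\ f x = f y] (u (f y)).
  by apply: xgetPex; exists y.
by apply: finj => //; exact: mem_set.
Qed.

Lemma closure_range_comp (u : nat -> T) (G : T -> E) x :
  continuous G -> closure (range u) x -> closure (range (G \o u)) (G x).
Proof.
move=> cG cx B /cG/cx[_ [[n _ <-] Bn]].
by exists (G (u n)); split => //; exists n.
Qed.

End separable_range.

Lemma continuous_borel_measurable (R : realType) (T : ptopologicalType)
    (f : T -> R) : continuous f -> measurable_fun (setT : set (borel T)) f.
Proof.
move=> cf; apply: (measurability _ (RGenOInfty.measurableE R)).
move=> _ [_ [r ->] <-]; rewrite setTI; apply: sub_sigma_algebra.
apply: (open_comp (f := f)) => [x _|]; first exact: cf.
by rewrite set_itvoy; exact: open_gt.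
Qed.

Section cond_prob.
Context d (Om : measurableType d) (R : realType) (P : probability Om R).

(** On measurable sets this is the restriction of [P] to [A], rescaled. The measure is finite rather
    than a probability because it is 0 when [P A] is 0. Equality holds as set functions, so
    integrals can be rewritten along it. *)
Lemma cond_prob_finite_measure (A : set Om) : measurable A ->
  exists mu : {finite_measure set Om -> \bar R}, mu = cond_prob P A :> (set Om -> \bar R).
Proof.
move=> mA; pose mu := cond_prob P A.
have k0 : 0 <= (fine (P A))^-1 by rewrite invr_ge0 fine_ge0.
have muE B : measurable B -> mu B = mscale (NngNum k0) (mrestr P mA) B.
  move=> mB; rewrite /mu /cond_prob /mscale /mrestr /= mulrC EFinM fineK//.
  by rewrite fin_num_measure//; exact: measurableI.
have mu0 : mu set0 = 0%E by rewrite muE// measure0.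
have mu_ge0 B : (0 <= mu B)%E.
  by rewrite lee_fin divr_ge0// fine_ge0.
have mu_sigma : semi_sigma_additive mu.
  move=> F mF tF mUF; rewrite muE//.
  under eq_fun do under eq_bigr do rewrite muE//.
  exact: measure_semi_sigma_additive.
have mu_fin : fin_num_fun mu by [].
pose mm := isMeasure.Build _ _ _ mu mu0 mu_ge0 mu_sigma.
pose M : {measure set Om -> \bar R} := HB.pack mu mm.
pose FM : {finite_measure set Om -> \bar R} :=
  HB.pack (Measure.sort M) (Measure_isFinite.Build _ _ _ M mu_fin).
by exists FM.
Qed.

End cond_prob.

Section sphere.
Context {R : realType} {H : hilbertType R}.

Lemma measurable_sphere : measurable (@sphere R H : set (borel H)).
Proof.
rewrite /sphere -[X in measurable X]setTI.
have := @continuous_borel_measurable R H _ (@norm_continuous _ H).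
by move=> /(_ measurableT [set 1]); apply.
Qed.

Context d (Om : measurableType d) (mu : {finite_measure set Om -> \bar R}).
Variable (phi : Om -> borel H).
Hypotheses (mphi : measurable_fun setT phi)
  (mu_sphere : mu (phi @^-1` (~` @sphere R H)) = 0%E).

(** Change of variables, after discarding the null set where [phi] leaves the sphere. It links
    integrals over the sample space to the integrals over the sphere that define weak
    convergence. *)
Lemma integral_pushforward_sphere (f : H -> R) : continuous f ->
  (forall x, 0 <= f x) ->
  (\int[mu]_w (f (phi w))%:E = \int[pushforward mu phi]_(x in @sphere R H) (f x)%:E)%E.
Proof.
move=> cf f0.
have mf : measurable_fun setT (fun w => f (phi w)).
  exact: (measurableT_comp (continuous_borel_measurable cf) mphi).
rewrite ge0_integral_pushforward//; last 3 first.
- exact: measurable_sphere.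
- apply/measurable_EFinP; apply: measurable_funTS.
  exact: continuous_borel_measurable.
- by move=> x _; rewrite lee_fin.
rewrite [LHS](ge0_negligible_integral _ _ _ _ mu_sphere)//.
- by rewrite setTD preimage_setC setCK.
- rewrite -[X in measurable X]setTI; apply: mphi => //.
  exact: (measurableC measurable_sphere).
- exact/measurable_EFinP.
- by move=> x _; rewrite lee_fin.
Qed.

Context (E : completeNormedModType R) (c : nat -> E) (G : H -> E).
Hypotheses (cG : continuous G) (Gc : forall x, closure (range c) (G x))
  (G1 : forall x, sphere x -> `|G x| <= 1).

Let continuous_distG v : continuous (fun x => `|G x - v|).
Proof.
move=> x; apply: (@cvg_norm _ E); apply: cvgB; [exact: cG|exact: cvg_cst].
Qed.

Lemma measurable_distG v : measurable_fun setT (fun w => `|G (phi w) - v|).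
Proof.
exact: (measurableT_comp (continuous_borel_measurable (@continuous_distG v)) mphi).
Qed.

Lemma integral_normG_lty : (\int[mu]_w `|G (phi w)|%:E < +oo)%E.
Proof.
rewrite (@integral_pushforward_sphere (fun x => `|G x|))//; last first.
  by have := @continuous_distG 0; under eq_fun do rewrite subr0.
have mS := measurable_sphere.
apply: (@le_lt_trans _ _ (\int[pushforward mu phi]_(x in @sphere R H) 1)%E).
  apply: ge0_le_integral => //.
  apply/measurable_EFinP; apply: measurable_funTS.
  apply: continuous_borel_measurable.
  by have := @continuous_distG 0; under eq_fun do rewrite subr0.
rewrite integral_cst// mul1e /pushforward ltey_eq fin_num_measure//.
by rewrite -[X in measurable X]setTI; exact: mphi.
Qed.

(** Rules out the default value 0 of [bochner_integral]: [G] is bounded on the sphere and [mu] is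
    finite, so an integral exists. *)
Lemma bochner_integral_spec :
  is_bochner_integral mu (fun w => G (phi w))
    (bochner_integral mu (fun w => G (phi w))).
Proof.
apply: xgetPex; apply: (@bochner_integral_exists _ _ _ _ _ c).
- exact: measurable_distG.
- by move=> w; exact: Gc.
- exact: integral_normG_lty.
Qed.

End sphere.

Section angle.
Context {R : realType} {H : hilbertType R}.
Context d (Om : measurableType d) (P : probability Om R).
Variable X : {mfun Om >-> borel H}.

Lemma measurable_exceeds t : measurable (exceeds X t).
Proof.
have -> : exceeds X t = X @^-1` [set x : H | t < `|x|] by [].
apply: measurable_funPTI.
apply: sub_sigma_algebra.
apply: (@open_comp _ _ (fun x : H => `|x|) [set r | t < r]) => [x _|]; last exact: open_gt.
exact: norm_continuous.
Qed.

(** Normalization is continuous only away from the origin, which it sends to itself because the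
    inverse of 0 is 0. The preimage of an open set is thus an open set, possibly together with the
    origin. *)
Lemma measurable_angle : measurable_fun setT (angle X : Om -> borel H).
Proof.
apply: (@measurability _ _ _ (borel H) _ _ (@open H)) => // _ [U oU <-]; rewrite setTI.
have -> : angle X @^-1` U =
    X @^-1` [set x : H | U (`|x|^-1 *: x)] by [].
apply: measurable_funPTI.
pose V := [set x : H | x != 0 /\ U (`|x|^-1 *: x)].
have oV : open V.
  rewrite openE => x [x0 Ux]; rewrite /interior.
  have cx : `|y|^-1 *: y @[y --> x] --> `|x|^-1 *: x.
    apply: cvgZ; last exact: cvg_id.
    by apply: cvgV; [rewrite normr_eq0|exact: norm_continuous].
  have Ux' := cx _ (open_nbhs_nbhs (conj oU Ux)).
  near=> y; split; last by near: y.
  near: y; have := @norm_continuous _ H x.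
  move=> /cvgr_gt /(_ 0); rewrite normr_gt0 => /(_ x0).
  by apply: filterS => y; rewrite normr_gt0.
have -> : [set x : H | U (`|x|^-1 *: x)] = V `|` ([set 0] `&` [set _ | U 0]).
  apply/seteqP; split => x /=.
    have [->|x0] := eqVneq x 0; last by left.
    by rewrite scaler0; right.
  by case => [[]//|[-> ?]]; rewrite scaler0.
apply: measurableU; first exact: sub_sigma_algebra.
have [U0|U0] := pselect (U 0).
  rewrite (_ : [set _ | U 0] = setT) ?setIT; last by apply/seteqP; split.
  rewrite -[Y in measurable Y]setCK; apply: measurableC; apply: sub_sigma_algebra.
  exact/closed_openC/accessible_closed_set1/hausdorff_accessible/norm_hausdorff.
by rewrite (_ : [set _ | U 0] = set0) ?setI0; last by apply/seteqP; split.
Unshelve. all: by end_near. Qed.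

Lemma cond_prob_angle_sphere t : 0 <= t ->
  cond_prob P (exceeds X t) (angle X @^-1` (~` @sphere R H)) = 0%E.
Proof.
move=> t0; rewrite /cond_prob (_ : _ `&` _ = set0) ?measure0 ?mul0r//.
rewrite -subset0 => w [/= + tw]; apply.
have w0 : 0 < `|(X w : H)| by rewrite (le_lt_trans t0).
by rewrite /sphere /angle /= normrZ normfV normr_id mulVf// gt_eqF.
Qed.

End angle.

(** * Convergence of the second-moment operators of the angle *)

Theorem theorem4p1 (R : realType) (H : hilbertType R) (sepH : separable H)
    (e : onb H)
    (d : measure_display) (Om : measurableType d) (P : probability Om R)
    (X : {mfun Om >-> borel H})
    (alpha : R) (alpha_gt0 : 0 < alpha)
    (rvX : regularly_varying P X alpha)
    (Q : probability (borel H) R) (limX : limit_angular_measure P X Q)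
    (d' : measure_display) (Om' : measurableType d') (P' : probability Om' R)
    (Theta_oo : {mfun Om' >-> borel H})
    (lawTheta_oo : forall A : set (borel H), measurable A ->
       distribution P' Theta_oo A = Q A) :
  let C (t : R) : hs e :=
    bochner_integral (cond_prob P (exceeds X t))
      (fun w => tensor e (angle X w) (angle X w)) in
  let C_oo : hs e :=
    bochner_integral P' (fun w => tensor e (Theta_oo w) (Theta_oo w)) in
  `|C t - C_oo| @[t --> +oo] --> (0 : R).
Proof.
move=> C C_oo.
pose G (x : H) : hs e := tensor e x x.
have cG : continuous G by exact: continuous_tensor_diag.
have [u du] := separable_dense_seq 0 sepH.
pose c n := G (u n).
have Gc x : closure (range c) (G x) by exact: (closure_range_comp cG (du x)).
have G1 x : sphere x -> `|G x| <= 1.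
  by move=> x1; rewrite (le_trans (hs_norm_tensor _ _ _))// x1 mulr1.
have mTheta : measurable_fun setT Theta_oo by exact: measurable_funPT.
have Theta_sphere : P' (Theta_oo @^-1` (~` @sphere R H)) = 0%E.
  have mS := @measurable_sphere R H.
  have [Q1 _] := limX.
  have := lawTheta_oo _ (measurableC mS).
  rewrite /distribution /pushforward => ->.
  by rewrite probability_setC// Q1 subee.
have intQ (f : H -> R) : continuous f -> (forall x, 0 <= f x) ->
    (\int[P']_w (f (Theta_oo w))%:E = \int[Q]_(x in @sphere R H) (f x)%:E)%E.
  move=> cf f0; rewrite (integral_pushforward_sphere mTheta Theta_sphere cf f0).
  by apply: eq_measure_integral => A mA _; exact: lawTheta_oo.
(* Weak convergence of the angular laws, moved to the sample spaces. The two formulations agree once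
   [t] is nonnegative, where exceedance forces the angle onto the sphere. *)
have limf (f : H -> R) M : continuous f -> (forall x, 0 <= f x) ->
    (forall x, sphere x -> f x <= M) ->
    (\int[cond_prob P (exceeds X t)]_w (f (angle X w))%:E @[t --> +oo%R] -->
     \int[P']_w (f (Theta_oo w))%:E)%E.
  move=> cf f0 fM; rewrite intQ//.
  have [_ /(_ f)limQ] := limX.
  have : (\int[angular_law P X t]_(x in @sphere R H) (f x)%:E @[t --> +oo%R] -->
     \int[Q]_(x in @sphere R H) (f x)%:E)%E.
    apply: limQ; first exact: continuous_subspaceT.
    by exists M => x x1; rewrite ger0_norm// fM.
  apply: cvg_trans; apply: near_eq_cvg.
  near=> t; have t0 : 0 <= t by near: t; exact: nbhs_pinfty_ge.
  have := @cond_prob_angle_sphere _ _ _ _ P X t t0.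
  have -> : angular_law P X t = pushforward (cond_prob P (exceeds X t)) (angle X : Om -> borel H) by [].
  have [mu <-] := cond_prob_finite_measure P (measurable_exceeds X t).
  by move=> mu0; rewrite (integral_pushforward_sphere (measurable_angle X) mu0 cf f0).
have specQ : is_bochner_integral P' (fun w => G (Theta_oo w)) C_oo.
  exact: (bochner_integral_spec mTheta Theta_sphere cG Gc G1).
have mdistQ := measurable_distG mTheta cG.
have [iQ] : (\int[P']_w `|G (Theta_oo w)|%:E < +oo)%E.
  exact: (integral_normG_lty mTheta Theta_sphere cG G1).
apply/cvgr0Pnorm_le => eps eps0.
(* Error budget: [eps / 4] between [C_oo] and [J_oo], [eps / 4] between [J_oo] and [J t], and
   [eps / 2] between [J t] and [C t]. The partition is chosen for the limit law alone and stays
   fixed as [t] grows. *)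
have eps4 : 0 < eps / 4 by rewrite divr_gt0.
have [del [n [del0 del_eps]]] := exists_punity mdistQ (fun w => Gc (Theta_oo w)) iQ eps4.
pose p (k : 'I_n.+1) x := punity c del k (G x).
pose b (k : 'I_n.+1) := pcenter c k.
have cp k : continuous (p k).
  move=> x; exact: (continuous_comp (cG x) (@continuous_punity _ _ c del n k (G x))).
have p0 k x : 0 <= p k x by exact: punity_ge0.
have p1 x : \sum_(k < n.+1) p k x = 1 by exact: punity_sum1.
have ple1 k x : p k x <= 1 by rewrite -(p1 x) (bigD1 k)//= lerDl sumr_ge0.
pose B x := \sum_(k < n.+1) p k x * `|G x - b k|.
have B0 x : 0 <= B x by apply: sumr_ge0 => k _; rewrite mulr_ge0.
have cB : continuous B.
  move=> x; apply: cvg_big => [|k _]; first exact: add_continuous.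
  apply: cvgM; first exact: cp.
  by apply: (@cvg_norm _ (hs e)); apply: cvgB; [exact: cG|exact: cvg_cst].
have BM x : sphere x -> B x <= 2 * del + 1.
  move=> /G1 Gx; rewrite (le_trans (punity_dist_le c del0 n (G x)))// lerD2l.
  by rewrite mulr_ile1// ?uncovered_ge0// uncovered_le1.
rewrite -/(B _) => BQ.
have limB := limf B _ cB B0 BM.
have limp k := limf (p k) 1 (cp k) (p0 k) (fun x _ => ple1 k x).
pose J t := \sum_(k < n.+1)
  fine (\int[cond_prob P (exceeds X t)]_w (p k (angle X w))%:E)%E *: b k.
pose J_oo := \sum_(k < n.+1) (\int[P']_w p k (Theta_oo w)) *: b k.
have mp d1 (T : measurableType d1) (phi : T -> borel H) k :
    measurable_fun setT phi -> measurable_fun setT (fun w => p k (phi w)).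
  by move=> mphi; exact: (measurableT_comp (continuous_borel_measurable (@cp k)) mphi).
have limJ : J t @[t --> +oo] --> J_oo.
  apply: cvg_big => [|k _]; first exact: add_continuous.
  apply: cvgZ; last exact: cvg_cst.
  apply: fine_cvg; rewrite fineK//.
  rewrite ge0_fin_numE; last by apply: integral_ge0 => w _; rewrite lee_fin.
  apply: (@le_lt_trans _ _ (\int[P']_w 1)%E).
    apply: ge0_le_integral => //.
    - by move=> w _; rewrite lee_fin.
    - by apply/measurable_EFinP; exact: mp.
    - by move=> w _; rewrite lee_fin.
  by rewrite integral_cst// mul1e ltey_eq fin_num_measure.
have distQ : `|C_oo - J_oo| <= eps / 4.
  rewrite -lee_fin (le_trans _ BQ)//.
  by apply: (@dist_bochner_integral _ _ _ _ P' _ (fun k w => p k (Theta_oo w))) => // k; exact: mp.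
(* The strict gap between [eps / 4] and [eps / 2] lets the bound pass to the conditional laws for
   all large [t]. *)
have eps4B : (\int[P']_w (B (Theta_oo w))%:E < (eps / 2)%:E)%E.
  by rewrite (le_lt_trans BQ)// lte_fin ltr_pM2l// ltf_pV2// ?posrE// ltr_nat.
have /cvgrPdist_le/(_ _ eps4) limJ' := limJ.
have limB' := limB _ (open_ereal_lt' eps4B).
near=> t.
have t0 : 0 <= t by near: t; exact: nbhs_pinfty_ge.
have Jt : `|J_oo - J t| <= eps / 4 by near: t.
have Bt : (\int[cond_prob P (exceeds X t)]_w (B (angle X w))%:E < (eps / 2)%:E)%E by near: t.
(* The conditional law is replaced by an equal finite measure, for which the Bochner estimate is
   available. *)
have CJ : `|C t - J t| <= eps / 2.
  have := @cond_prob_angle_sphere _ _ _ _ P X t t0; move: Bt; rewrite /C /J.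
  have [mu <-] := cond_prob_finite_measure P (measurable_exceeds X t).
  move=> Bt mu0.
  have mdist := measurable_distG (measurable_angle X) cG.
  have spec := bochner_integral_spec (measurable_angle X) mu0 cG Gc G1.
  rewrite -lee_fin (le_trans _ (ltW Bt))//.
  by apply: (@dist_bochner_integral _ _ _ _ mu _ (fun k w => p k (angle X w))) => // k;
    apply: mp; exact: measurable_angle.
rewrite normr_id.
rewrite (le_trans (ler_distD (J t) _ _))// (splitr eps) lerD//.
rewrite (le_trans (ler_distD J_oo _ _))// (_ : eps / 2 = eps / 4 + eps / 4); last by field.
by rewrite lerD// distrC.
Unshelve. all: by end_near. Qed.
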